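(* Let $G = \mathbb{Z}_2 \wr_r \mathbb{Z}$ be the restricted wreath product of $\mathbb{Z}_2$ and $\mathbb{Z}$. Then $\operatorname{asdim} G = 1$ and $G$ is not virtually free.
   Context: Here $\mathbb{Z}_2 = \mathbb{Z}/2\mathbb{Z}$, and the restricted wreath product $\mathbb{Z}_2 \wr_r \mathbb{Z}$ is the semidirect product $\left(\bigoplus_{\mathbb{Z}} \mathbb{Z}_2\right) \rtimes \mathbb{Z}$, where $\mathbb{Z}$ acts by shifting the coordinates. It is a finitely generated group. Cayley graph: for a group $G$ with generating set $S$, the Cayley graph is the 1-dimensional complex with a vertex for each element of $G$ and an edge joining $x$ to $xs$ for every $x \in G$ and $s \in S$. It is a geodesic metric space with the path metric in which each edge has length $1$. A finitely generated group $G$ is regarded as a metric space via its Cayley graph with respect to a finite generating set; $\operatorname{asdim} G$ means the asymptotic dimension of this metric space (it is invariant under quasi-isometry, so it does not depend on the finite generating set). Asymptotic dimension: for subsets $A,B$ of a metric space $(X,d)$ put $d(A,B)=\inf\{d(a,b): a\in A, b\in B\}$. For a real number $d>0$, a metric space $Y$ is $d$-disconnected if there are subsets $B_i \subset Y$ ($i \in I$) with $Y = \bigcup_{i \in I} B_i$, $\sup\{\operatorname{diam} B_i : i \in I\} < \infty$, and $d(B_i,B_j) \geq d$ for all $i \neq j$. Then $\operatorname{asdim} X = n$ if $n$ is the minimal non-negative integer such that for every $d>0$ one can write $X = \bigcup_{k=0}^{n} X_k$ with all $X_k$ $d$-disconnected. Virtually free: a group $G$ is virtually free if it has a finite index subgroup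 $H$ that is a free group. *)

(* Defs.v *)
From HB Require Import structures.
From mathcomp Require Import all_boot all_order all_algebra finmap.
From mathcomp Require Import all_classical all_reals ereal topology.
From mathcomp Require Import lra.

Set Implicit Arguments.
Unset Strict Implicit.
Unset Printing Implicit Defensive.

Import Order.TTheory GRing.Theory Num.Theory.

Local Open Scope classical_set_scope.
Local Open Scope ring_scope.

Section AsymptoticDimension.
Variables (R : realType) (X : metricType R).

(* Extended-real valued: [set_dist A B = +oo] when [A] or [B] is empty, and
   [diam set0 = -oo], so that empty pieces are harmless below. *)
Definition set_dist (A B : set X) : \bar R :=
  ereal_inf [set (mdist z.1 z.2)%:E | z in A `*` B].

Definition diam (A : set X) : \bar R :=
  ereal_sup [set (mdist z.1 z.2)%:E | z in A `*` A].

Definition disconnected_at (d : R) (Y : set X) : Prop :=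
  exists (I : Type) (B : I -> set X),
    [/\ Y = \bigcup_i B i,
        (ereal_sup [set diam (B i) | i in [set: I]] < +oo)%E &
        forall i j, i <> j -> (d%:E <= set_dist (B i) (B j))%E].

Definition asdim_le (n : nat) : Prop :=
  forall d : R, 0 < d ->
  exists Y : 'I_n.+1 -> set X,
    [set: X] = \bigcup_k Y k /\ forall k, disconnected_at d (Y k).

Definition asdim_eq (n : nat) : Prop :=
  asdim_le n /\ forall m, asdim_le m -> (n <= m)%N.

End AsymptoticDimension.

Arguments asdim_eq {R} X n.

Definition generates (G : groupType) (S : {fset G}) : Prop :=
  forall H : groupClosed G, {subset S <= H} -> forall x : G, x \in H.

Section CayleyGraph.
Variables (R : realType) (G : groupType) (S : {fset G}).

(* The points of the 1-dimensional complex: a vertex for each element of [G]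
   and, for each [x : G] and [s] in [S], an open edge, parametrized by ]0, 1[
   from its origin [x] to its end [x * s]. *)
Definition cayley_point : Type :=
  (G + (G * S) * {t : R | 0 < t < 1})%type.

Definition vertex (x : G) : cayley_point := inl x.

Definition edge_interior (x : G) (s : S) (t : {t : R | 0 < t < 1}) :
  cayley_point := inr ((x, s), t).

(* [on_edge x s t p]: [p] is the point of parameter [t] (in [0, 1]) of the
   closed edge from [x] to [x * s]. *)
Inductive on_edge (x : G) (s : S) : R -> cayley_point -> Prop :=
| on_edge_start : on_edge x s 0 (vertex x)
| on_edge_end : on_edge x s 1 (vertex (x * val s)%g)
| on_edge_interior t : on_edge x s (val t) (edge_interior x s t).

(* [pl_path p q l]: there is a piecewise linear path of length [l] from [p] to
   [q], i.e., a finite concatenation of segments, each inside a closed edge. *)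
Inductive pl_path : cayley_point -> cayley_point -> R -> Prop :=
| pl_path_nil p : pl_path p p 0
| pl_path_cons x s t u p q r l :
    on_edge x s t p -> on_edge x s u q -> pl_path q r l ->
    pl_path p r (`|t - u| + l).

Definition path_dist (p q : cayley_point) : R := inf [set l | pl_path p q l].

Lemma pl_path_ge0 p q l : pl_path p q l -> 0 <= l.
Proof. by elim=> // *; rewrite addr_ge0. Qed.

Lemma pl_path_cat p q r l m :
  pl_path p q l -> pl_path q r m -> pl_path p r (l + m).
Proof.
elim=> [?|x s t u a b c k ta ub _ IH] qr; first by rewrite add0r.
by rewrite -addrA; apply: (pl_path_cons ta ub); exact: IH.
Qed.

Lemma pl_path_seg x s t u p q :
  on_edge x s t p -> on_edge x s u q -> pl_path p q `|t - u|.
Proof.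
move=> tp uq; rewrite -[X in pl_path _ _ X]addr0.
by apply: (pl_path_cons tp uq); exact: pl_path_nil.
Qed.

Lemma pl_path_rev p q l : pl_path p q l -> pl_path q p l.
Proof.
elim=> [?|x s t u a b c k ta ub _ IH]; first exact: pl_path_nil.
by rewrite addrC distrC; apply: (pl_path_cat IH); exact: pl_path_seg ub ta.
Qed.

Lemma path_dist_le p q l : pl_path p q l -> path_dist p q <= l.
Proof.
by move=> pq; apply: ge_inf => //; exists 0 => m /=; exact: pl_path_ge0.
Qed.

Lemma path_dist_sym p q : path_dist p q = path_dist q p.
Proof.
by congr inf; apply/seteqP; split=> l /=; exact: pl_path_rev.
Qed.

Lemma path_distxx p : path_dist p p = 0.
Proof.
apply/eqP; rewrite eq_le path_dist_le /=; last exact: pl_path_nil.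
by apply: lb_le_inf => [|l /= /pl_path_ge0//]; exists 0; exact: pl_path_nil.
Qed.

Definition edge_lipschitz (f : cayley_point -> R) : Prop :=
  forall x s t u p q, on_edge x s t p -> on_edge x s u q ->
    f q <= f p + `|t - u|.

Lemma pl_path_lipschitz f p q l :
  edge_lipschitz f -> pl_path p q l -> f q <= f p + l.
Proof.
move=> fL; elim=> [?|x s t u a b c k ta ub _ IH]; first by rewrite addr0.
by have := fL _ _ _ _ _ _ ta ub; lra.
Qed.

Lemma separating_vertex (x : G) : exists f, [/\ edge_lipschitz f,
  f (vertex x) = 0 & forall q, q <> vertex x -> 0 < f q].
Proof.
pose phi (v : G) : R := (v != x)%:R.
have phi01 v : 0 <= phi v <= 1 by rewrite /phi; case: (_ != _) => /=; lra.
pose f (p : cayley_point) := match p with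
  | inl v => phi v
  | inr (y, s, t) => Num.min (phi y + val t) (phi (y * val s)%g + 1 - val t)
  end.
exists f; split.
- move=> y s t u p q tp uq.
  have [n1 n2] : t - u <= `|t - u| /\ u - t <= `|t - u|.
    by rewrite {2}distrC !ler_norm.
  have p0 := phi01 y; have p1 := phi01 (y * val s)%g.
  move: `|t - u| n1 n2 p0 p1 => n.
  case: tp => [||a]; case: uq => [||b] /= n1 n2 p0 p1.
  all: do ?[lra].
  + by rewrite ge_min; apply/orP; left; lra.
  + by rewrite ge_min; apply/orP; right; lra.
  + by have := valP a; rewrite /= minEle; case: ifP => _; lra.
  + by have := valP a; rewrite /= minEle; case: ifP => _; lra.
  + rewrite -lerBlDr le_min !lerBlDr.
    by apply/andP; split; rewrite ge_min; apply/orP; [left|right]; lra.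
- by rewrite /= /phi eqxx.
- move=> [v|[[y s] t]] /= qx.
    by rewrite /phi; case: eqP => [vx|]; [case: qx; rewrite vx | rewrite /=; lra].
  have := phi01 y; have := phi01 (y * val s)%g; have := valP t => /=.
  by rewrite lt_min => *; apply/andP; split; lra.
Qed.

Lemma separating_interior (x : G) (s : S) t : exists f, [/\ edge_lipschitz f,
  f (edge_interior x s t) = 0 & forall q, q <> edge_interior x s t -> 0 < f q].
Proof.
have /= t01 := valP t.
pose m : R := Num.min (sval t) (1 - sval t).
have m0 : 0 < m by rewrite lt_min; apply/andP; split; lra.
have mt : m <= sval t by rewrite ge_min lexx.
have m1 : m <= 1 - sval t by rewrite ge_min lexx orbT.
move: m m0 mt m1 => m m0 mt m1.
pose f (p : cayley_point) := match p with
  | inl _ => m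
  | inr (e, u) => if e == (x, s) then Num.min `|val u - val t| m else m
  end.
exists f; split.
- move=> y u a b p q ap bq.
  have [n1 n2] : a - b <= `|a - b| /\ b - a <= `|a - b|.
    by rewrite {2}distrC !ler_norm.
  have := normr_ge0 (a - b).
  move: `|a - b| n1 n2 => n.
  case: ap => [||a']; case: bq => [||b'] /= n1 n2 n0.
  all: do ?[lra].
  + by case: eqP => _; [rewrite ge_min; apply/orP; right|]; lra.
  + by case: eqP => _; [rewrite ge_min; apply/orP; right|]; lra.
  + case: eqP => _; last lra.
    rewrite -lerBlDr le_min !lerBlDr; apply/andP; split; last lra.
    by case: ler0P; have := valP a'; rewrite /=; lra.
  + case: eqP => _; last lra.
    rewrite -lerBlDr le_min !lerBlDr; apply/andP; split; last lra.
    by case: ler0P; have := valP a'; rewrite /=; lra.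
  + case: eqP => _; last lra.
    rewrite -lerBlDr le_min !lerBlDr; apply/andP; split; last first.
      by rewrite ge_min; apply/orP; right; lra.
    rewrite ge_min; apply/orP; left.
    by case: ler0P => ?; case: ler0P => ?; lra.
- by rewrite /= eqxx subrr normr0 minEle (ltW m0).
- move=> [//|[e u]] /= qp; case: eqP => // ee; rewrite lt_min m0 andbT.
  rewrite normr_gt0 subr_eq0; apply/eqP => /val_inj ut.
  by apply: qp; rewrite ee ut.
Qed.

Lemma vertex_connected (x y : G) : generates S ->
  exists l, pl_path (vertex x) (vertex y) l.
Proof.
move=> gS.
pose P : {pred G} := [pred g | `[< forall z, exists l,
  pl_path (vertex z) (vertex (z * g)%g) l >]].
have P1 : 1%g \in P.
  by apply/asboolP => z; exists 0; rewrite mulg1; exact: pl_path_nil.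
have PM : mulg_closed P.
  move=> a b /asboolP aP /asboolP bP; apply/asboolP => z.
  have [l za] := aP z; have [k ab] := bP (z * a)%g.
  by exists (l + k); rewrite mulgA; exact: pl_path_cat za ab.
have PV : invg_closed P.
  move=> a /asboolP aP; apply/asboolP => z.
  by have [l za] := aP (z * a^-1)%g; rewrite mulgVK in za;
    exists l; exact: pl_path_rev.
pose H : groupClosed G := HB.pack P (isMul1Closed.Build G P P1)
  (isMulClosed.Build G P PM) (isInvClosed.Build G P PV).
have SH : {subset S <= H}.
  move=> s sS; apply/asboolP => z; exists `|0 - 1|.
  exact: (pl_path_seg (on_edge_start z [` sS]%fset)
    (on_edge_end z [` sS]%fset)).
have /asboolP/(_ x) := gS H SH (x^-1 * y)%g.
by rewrite mulgA mulgV mul1g.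
Qed.

Lemma vertex_near p : exists x l, pl_path p (vertex x) l.
Proof.
case: p => [x|[[x s] t]]; first by exists x, 0; exact: pl_path_nil.
exists x, `|val t - 0|.
exact: pl_path_seg (on_edge_interior x s t) (on_edge_start x s).
Qed.

Lemma pl_path_ex p q : generates S -> exists l, pl_path p q l.
Proof.
move=> gS; have [x [l px]] := vertex_near p; have [y [m qy]] := vertex_near q.
have [k xy] := vertex_connected x y gS.
exists (l + k + m); apply: (pl_path_cat _ (pl_path_rev qy)).
exact: pl_path_cat px xy.
Qed.

Lemma path_dist_triangle (gS : generates S) q p r :
  path_dist p r <= path_dist p q + path_dist q r.
Proof.
have [l0 pq0] := pl_path_ex p q gS; have [m0 qr0] := pl_path_ex q r gS.
rewrite -lerBlDl; apply: lb_le_inf => [|m qr]; first by exists m0.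
rewrite lerBlDl -lerBlDr; apply: lb_le_inf => [|l pq]; first by exists l0.
by rewrite lerBlDr; apply: path_dist_le; exact: pl_path_cat pq qr.
Qed.

Lemma path_dist_positivity (gS : generates S) p q :
  path_dist p q = 0 -> p = q.
Proof.
move=> pq0; apply: contrapT => pq.
have [f [fL fp fq]] : exists f, [/\ edge_lipschitz f, f p = 0 &
    forall r, r <> p -> 0 < f r].
  case: p {pq0 pq} => [x|[[x s] t]]; first exact: separating_vertex.
  exact: separating_interior.
have [l0 pq1] := pl_path_ex p q gS.
have : f q <= path_dist p q.
  apply: lb_le_inf => [|l /= pql]; first by exists l0.
  by have := pl_path_lipschitz fL pql; rewrite fp add0r.
by rewrite pq0 leNgt fq// => /esym.
Qed.

(* [S] must generate for all the path distances to be finite. *)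
Definition cayley_graph (gS : generates S) : Type := cayley_point.

HB.instance Definition _ (gS : generates S) :=
  Choice.copy (cayley_graph gS)
    (G + (G * S) * {t : R | 0 < t < 1})%type.

HB.instance Definition _ (gS : generates S) :=
  isMetric.Build R (cayley_graph gS) path_distxx (path_dist_positivity gS)
    path_dist_sym (path_dist_triangle gS).

End CayleyGraph.

Arguments cayley_graph R {G S} gS.

(* asdim G = n, for a finitely generated group G; as this does not depend on
   the finite generating set, it is required for all of them. *)
Definition group_asdim_eq (R : realType) (G : groupType) (n : nat) : Prop :=
  (exists S : {fset G}, generates S) /\
  forall (S : {fset G}) (gS : generates S), asdim_eq (cayley_graph R gS) n.

(* Free groups, through the universal property of a basis [X]. *)
Definition free_group (F : groupType) : Prop :=
  exists X : set F, forall (K : groupType) (f : F -> K),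
    exists phi : {multiplicative F -> K},
      (forall x, X x -> phi x = f x) /\
      forall psi : {multiplicative F -> K},
        (forall x, X x -> psi x = f x) -> psi =1 phi.

Definition finite_index (G : groupType) (H : {pred G}) : Prop :=
  finite_set [set [set (x * h)%g | h in [set` H]] | x in [set: G]].

Definition virtually_free (G : groupType) : Prop :=
  exists (P : {pred G}) (H : subGroupType P), finite_index P /\ free_group H.

Section RestrictedWreath.
Variable A : zmodType.

(* The direct sum of copies of [A] indexed by the integers, as finitely
   supported functions. *)
Definition dsum : Type := {fsfun int -> A with 0}.

HB.instance Definition _ := Choice.copy dsum {fsfun int -> A with 0}.

Definition dsum_fun (f : dsum) : int -> A := (f : {fsfun int -> A with 0}).

Definition dsum0 : dsum := [fsfun].

Definition dsum_add (f g : dsum) : dsum :=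
  [fsfun i in (finsupp f `|` finsupp g)%fset => dsum_fun f i + dsum_fun g i].

Definition dsum_opp (f : dsum) : dsum :=
  [fsfun i in finsupp f => - dsum_fun f i].

Definition shift (k : int) (f : dsum) : dsum :=
  [fsfun i in [fset (j + k)%R | j in finsupp f]%fset => dsum_fun f (i - k)].

Lemma dsumP (f g : dsum) : dsum_fun f =1 dsum_fun g -> f = g.
Proof. by move=> fg; apply/fsfunP => i; exact: fg. Qed.

Lemma dsum0E i : dsum_fun dsum0 i = 0.
Proof. by rewrite /dsum_fun fsfun0E. Qed.

Lemma dsum_addE f g i : dsum_fun (dsum_add f g) i = dsum_fun f i + dsum_fun g i.
Proof.
rewrite {1}/dsum_fun fsfunE in_fsetU /dsum_fun.
have [//|f0] := boolP (i \in finsupp f); have [//|g0] := boolP (i \in finsupp g).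
by rewrite !fsfun_dflt// addr0.
Qed.

Lemma dsum_oppE f i : dsum_fun (dsum_opp f) i = - dsum_fun f i.
Proof.
rewrite {1}/dsum_fun fsfunE /dsum_fun.
by have [//|f0] := boolP (i \in finsupp f); rewrite fsfun_dflt// oppr0.
Qed.

Lemma shiftE k f i : dsum_fun (shift k f) i = dsum_fun f (i - k).
Proof.
rewrite {1}/dsum_fun fsfunE; case: ifPn => // /negP nk.
rewrite /dsum_fun fsfun_dflt//; apply/negP => ik; apply: nk.
by apply/imfsetP; exists (i - k) => //=; rewrite subrK.
Qed.

Lemma dsum_addA : associative dsum_add.
Proof. by move=> f g h; apply: dsumP => i; rewrite !dsum_addE addrA. Qed.

Lemma dsum_addC : commutative dsum_add.
Proof. by move=> f g; apply: dsumP => i; rewrite !dsum_addE addrC. Qed.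

Lemma dsum_add0 : left_id dsum0 dsum_add.
Proof. by move=> f; apply: dsumP => i; rewrite dsum_addE dsum0E add0r. Qed.

Lemma dsum_addN : left_inverse dsum0 dsum_opp dsum_add.
Proof.
by move=> f; apply: dsumP => i; rewrite dsum_addE dsum_oppE dsum0E addNr.
Qed.

HB.instance Definition _ :=
  GRing.isZmodule.Build dsum dsum_addA dsum_addC dsum_add0 dsum_addN.

Lemma shiftD k (f g : dsum) : shift k (f + g) = shift k f + shift k g.
Proof. by apply: dsumP => i; rewrite dsum_addE !shiftE dsum_addE. Qed.

Lemma shift_add k l f : shift (k + l) f = shift k (shift l f).
Proof. by apply: dsumP => i; rewrite !shiftE opprD addrA. Qed.

Lemma shift0 f : shift 0 f = f.
Proof. by apply: dsumP => i; rewrite shiftE subr0. Qed.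

(* The semidirect product of [dsum] by the integers acting through [shift]. *)
Definition wreathZ : Type := (dsum * int)%type.

HB.instance Definition _ := Choice.copy wreathZ (dsum * int)%type.

Definition wreath_mul (a b : wreathZ) : wreathZ :=
  (a.1 + shift a.2 b.1, a.2 + b.2).

Definition wreath_one : wreathZ := (0, 0).

Definition wreath_inv (a : wreathZ) : wreathZ :=
  (shift (- a.2) (- a.1), - a.2).

Lemma wreath_mulA : associative wreath_mul.
Proof.
move=> [f k] [g l] [h m]; rewrite /wreath_mul /=.
by rewrite shiftD -shift_add !addrA.
Qed.

Lemma wreath_mul1g : left_id wreath_one wreath_mul.
Proof. by move=> [f k]; rewrite /wreath_mul /= shift0 !add0r. Qed.

Lemma wreath_mulg1 : right_id wreath_one wreath_mul.
Proof.
move=> [f k]; rewrite /wreath_mul /= addr0; congr pair.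
by apply: dsumP => i; rewrite dsum_addE shiftE !dsum0E addr0.
Qed.

Lemma wreath_mulVg : left_inverse wreath_one wreath_inv wreath_mul.
Proof.
move=> [f k]; rewrite /wreath_mul /= -shiftD !addNr; congr pair.
by apply: dsumP => i; rewrite shiftE !dsum0E.
Qed.

Lemma wreath_mulgV : right_inverse wreath_one wreath_inv wreath_mul.
Proof.
by move=> [f k]; rewrite /wreath_mul /= -shift_add subrr shift0 subrr.
Qed.

HB.instance Definition _ := isGroup.Build wreathZ
  wreath_mulA wreath_mul1g wreath_mulg1 wreath_mulVg wreath_mulgV.

End RestrictedWreath.

(* Main.v *)
Require Import Defs.
From HB Require Import structures.
From mathcomp Require Import all_boot all_order all_algebra finmap.
From mathcomp Require Import all_classical all_reals ereal topology.
From mathcomp Require Import lra zify.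

(** Write the elements of the wreath product as (f, n), and let N (f, n) be the
    least m such that |n| <= m and f is supported in [-m, m]. N is subadditive,
    hence at most a constant times the word length for any finite generating
    set, and its balls are finite, hence bounded for the word metric. Cut Z into
    intervals of length m: the even and the odd ones give the two subsets. Over
    one interval I, a step of length N < m only changes f near I, so the pieces
    of given I and given restriction of f away from I are far apart, and they
    are bounded. Dimension 0 is excluded because a Cayley graph is connected
    and this one is unbounded.

    A finite index subgroup contains a product of two distinct conjugates of
    the lamp, which is an involution, whereas a free group F has none. Indeed
    let h be one, and choose e : F -> Z/2 with e (z h) = e z + 1. The cocycle
    d_w (z) = e z - e (w^-1 z) takes values in the functions F/<h> -> Z/2; as F
    is free it lifts to a cocycle D with values in the functions F/<h> -> Z.
    Then 0 = D_1 (1) = D_(h h) (1) = 2 D_h (1), but D_h (1) is odd. *)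

Set Implicit Arguments.
Unset Strict Implicit.
Unset Printing Implicit Defensive.

Import Order.TTheory GRing.Theory Num.Theory.

Local Open Scope classical_set_scope.
Local Open Scope ring_scope.

(** * Free groups have no involution *)

Section CoinducedProduct.
Variables (F : groupType) (M : zmodType).

(* The semidirect product of the coinduced module [F -> M], on which [F] acts
   by left translations, and [F]. *)
Definition coind_prod : Type := ((F -> M) * F)%type.

HB.instance Definition _ := Choice.copy coind_prod ((F -> M) * F)%type.

Definition coind_mul (a b : coind_prod) : coind_prod :=
  (fun z => a.1 z + b.1 (a.2^-1 * z)%g, (a.2 * b.2)%g).

Definition coind_one : coind_prod := (fun=> 0, 1%g).

Definition coind_inv (a : coind_prod) : coind_prod :=
  (fun z => - a.1 (a.2 * z)%g, a.2^-1%g).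

Lemma coind_mulA : associative coind_mul.
Proof.
move=> [u x] [v y] [w z]; rewrite /coind_mul /= mulgA; congr pair.
by apply/funext => t; rewrite addrA invgM mulgA.
Qed.

Lemma coind_mul1g : left_id coind_one coind_mul.
Proof.
move=> [u x]; rewrite /coind_mul /= mul1g; congr pair.
by apply/funext => t; rewrite add0r invg1 mul1g.
Qed.

Lemma coind_mulg1 : right_id coind_one coind_mul.
Proof.
move=> [u x]; rewrite /coind_mul /= mulg1; congr pair.
by apply/funext => t; rewrite addr0.
Qed.

Lemma coind_mulVg : left_inverse coind_one coind_inv coind_mul.
Proof.
move=> [u x]; rewrite /coind_mul /= mulVg; congr pair.
by apply/funext => t; rewrite invgK addNr.
Qed.

Lemma coind_mulgV : right_inverse coind_one coind_inv coind_mul.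
Proof.
move=> [u x]; rewrite /coind_mul /= mulgV; congr pair.
by apply/funext => t; rewrite mulVKg subrr.
Qed.

HB.instance Definition _ := isGroup.Build coind_prod
  coind_mulA coind_mul1g coind_mulg1 coind_mulVg coind_mulgV.

Lemma coind_mulE (a b : coind_prod) : (a * b)%g = coind_mul a b.
Proof. by []. Qed.

End CoinducedProduct.

Definition free_basis (F : groupType) (X : set F) : Prop :=
  forall (K : groupType) (f : F -> K),
    exists phi : {multiplicative F -> K},
      (forall x, X x -> phi x = f x) /\
      forall psi : {multiplicative F -> K},
        (forall x, X x -> psi x = f x) -> psi =1 phi.

(** Both maps extend the values of [psi] on the basis, so uniqueness applies. Bare functions are
    allowed because the maps compared below are built by hand. *)
Lemma hom_eq_on_basis (F : groupType) (X : set F) :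
  free_basis X ->
  forall (K : groupType) (phi psi : F -> K),
    {morph phi : x y / (x * y)%g} -> {morph psi : x y / (x * y)%g} ->
    (forall x, X x -> phi x = psi x) -> phi =1 psi.
Proof.
move=> FX K phi psi phiM psiM e x; have [chi [_ chiP]] := FX K psi.
pose phi' : {multiplicative F -> K} :=
  HB.pack phi (isMultiplicative.Build F K phi phiM).
pose psi' : {multiplicative F -> K} :=
  HB.pack psi (isMultiplicative.Build F K psi psiM).
by rewrite -[LHS]/(phi' x) -[RHS]/(psi' x) chiP// [RHS]chiP.
Qed.

(* Right translation by [h] is free: [e] marks one point in each orbit. *)
Lemma involution_section (F : groupType) (h : F) :
  (h * h)%g = 1%g -> h <> 1%g ->
  exists e : F -> 'Z_2, forall z, e (z * h)%g = e z + 1.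
Proof.
move=> hh h1; pose P (z w : F) := (w == z) || (w == z * h)%g.
pose rep z := choose (P z) z.
have zhh z : (z * h * h)%g = z by rewrite -mulgA hh mulg1.
have zh z : (z == z * h)%g = false.
  by apply/eqP; rewrite -{1}[z]mulg1 => /mulgI/esym.
have Pz z : P z z by rewrite /P eqxx.
have repM z : rep (z * h)%g = rep z.
  (* The representative depends on the orbit only, not on the default point. *)
  transitivity (choose (P z) (z * h)%g).
    by apply: eq_choose => w; rewrite /P zhh orbC.
  by apply: choose_id; rewrite /P eqxx ?orbT.
exists (fun z => (rep z == z)%:R) => z; rewrite repM.
have /orP[] : P z (rep z) by exact: chooseP.
  by move=> /eqP ->; rewrite eqxx zh; apply/val_inj.
by move=> /eqP ->; rewrite eqxx [(_ == z)%g]eq_sym zh; apply/val_inj.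
Qed.

Lemma free_group_no_involution (F : groupType) (h : F) :
  free_group F -> (h * h)%g = 1%g -> h = 1%g.
Proof.
move=> [X FX] hh; apply: contrapT => h1.
have [e eh] := involution_section hh h1.
pose d (w z : F) : 'Z_2 := e z - e (w^-1 * z)%g.
(* [val] lifts residues to [0] or [1]; freeness allows these lifts to be prescribed on the basis. *)
have [D [DX _]] := FX (coind_prod F int)
  (fun x => (fun z => (val (d x z) : nat)%:Z, x)).
have DM : {morph D : x y / (x * y)%g} by move=> x y; rewrite gmulfM.
have D2 : forall w, (D w).2 = w.
  apply: (hom_eq_on_basis FX) => [x y|x y //|x Xx]; first by rewrite DM.
  by rewrite DX.
(* Reducing [D] modulo 2 gives a homomorphism, and so does [d], being a coboundary; they agree on
   the basis. *)
have Dd w z : ((D w).1 z)%:~R = d w z.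
  pose phi w : coind_prod F 'Z_2 := (fun z => ((D w).1 z)%:~R, w).
  pose psi w : coind_prod F 'Z_2 := (d w, w).
  suff : phi =1 psi by move=> /(_ w) [] /(congr1 (@^~ z)).
  apply: (hom_eq_on_basis FX) => [x y|x y|x Xx].
  - rewrite coind_mulE /coind_mul /phi /= DM; congr pair.
    by apply/funext => t /=; rewrite intrD D2.
  - rewrite coind_mulE /coind_mul /psi /=; congr pair.
    by apply/funext => t; rewrite /d invgM -mulgA addrA subrK.
  - rewrite /phi /psi DX//; congr pair.
    by apply/funext => t; exact: natr_Zp.
(* Right translation commutes with the left action, so invariance is checked on the basis, where the
   two increments of [e] cancel. *)
have Dh w z : (D w).1 (z * h)%g = (D w).1 z.
  pose phi w : coind_prod F int := (fun z => (D w).1 (z * h)%g, w).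
  pose psi w : coind_prod F int := ((D w).1, w).
  suff : phi =1 psi by move=> /(_ w) [] /(congr1 (@^~ z)).
  apply: (hom_eq_on_basis FX) => [x y|x y|x Xx].
  - rewrite coind_mulE /coind_mul /phi /= DM; congr pair.
    by apply/funext => t /=; rewrite D2 mulgA.
  - by rewrite coind_mulE /coind_mul /psi /= DM /= D2.
  - rewrite /phi /psi DX//; congr pair.
    apply/funext => t; apply: (@congr1 _ _ (fun a : 'Z_2 => Posz (val a))).
    by rewrite /d mulgA !eh opprD addrACA subrr addr0.
have hV : (h^-1)%g = h by apply: mulg1_eq.
have D1 : (D 1%g).1 1%g = 0.
  have := DM 1%g 1%g; rewrite mulg1.
  move=> /(congr1 (fun a : coind_prod F int => a.1 1%g)).
  by rewrite coind_mulE /= D2 mulVg => /esym/(canRL (addrK _)); rewrite subrr.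
have Dhh := Dh h 1%g; have eh1 := eh 1%g; rewrite mul1g in Dhh eh1.
have /eqP : (D 1%g).1 1%g = (D h).1 1%g + (D h).1 1%g.
  by rewrite -{1}hh DM coind_mulE /= D2 hV mulg1 Dhh.
rewrite D1 => /eqP h0; have {}h0 : (D h).1 1%g = 0 by lia.
(* The reduction of [D h] at [1] is [e 1 - e h = -1], nonzero modulo 2. *)
have := Dd h 1%g; rewrite h0 /d hV mulg1 eh1 => /eqP.
by rewrite opprD addrA subrr.
Qed.

(** * Distances between vertices of a Cayley graph *)

(** The elements satisfying [P] form a subgroup containing [S], made boolean by classical
    reflection. *)
Lemma generates_ind (G : groupType) (S : {fset G}) (P : G -> Prop) :
  generates S -> P 1%g -> (forall g h, P g -> P h -> P (g * h)%g) ->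
  (forall g, P g -> P (g^-1)%g) -> (forall s : S, P (val s)) ->
  forall g, P g.
Proof.
move=> gS P1 PM PV PS g; pose Q : {pred G} := [pred g | `[< P g >]].
have Q1 : 1%g \in Q by exact/asboolP.
have QM : mulg_closed Q.
  by move=> a b /asboolP Pa /asboolP Pb; apply/asboolP; exact: PM.
have QV : invg_closed Q by move=> a /asboolP Pa; apply/asboolP; exact: PV.
pose H : groupClosed G := HB.pack Q (isMul1Closed.Build G Q Q1)
  (isMulClosed.Build G Q QM) (isInvClosed.Build G Q QV).
have SH : {subset S <= H}.
  by move=> s sS; apply/asboolP; exact: (PS [` sS]%fset).
exact/asboolP/(gS H SH).
Qed.

Section CayleyMetric.
Variables (R : realType) (G : groupType) (S : {fset G}).

Local Notation point := (cayley_point R S).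
Local Notation vertex := (@vertex R G S).
Local Notation dist := (@path_dist R G S).

(** Inside an edge, take the lower of the two functions of slope one rising from its ends; the
    hypothesis makes it match [phi] at both ends. *)
Lemma edge_lipschitz_extension (phi : G -> R) :
  (forall x (s : S), `|phi (x * val s)%g - phi x| <= 1) ->
  exists f : point -> R, edge_lipschitz f /\ forall x, f (vertex x) = phi x.
Proof.
move=> phi1.
pose f (p : point) := match p with
  | inl v => phi v
  | inr (y, s, t) => Num.min (phi y + val t) (phi (y * val s)%g + 1 - val t)
  end.
exists f; split=> // y s t u p q tp uq.
have [n1 n2] : t - u <= `|t - u| /\ u - t <= `|t - u|.
  by rewrite {2}distrC !ler_norm.
have := phi1 y s; rewrite ler_norml => /andP[l1 l2].
move: `|t - u| n1 n2 => n.
case: tp => [||a]; case: uq => [||b] /= n1 n2.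
all: do ?[lra].
- by rewrite ge_min; apply/orP; left; lra.
- by rewrite ge_min; apply/orP; right; lra.
- by have := valP a; rewrite /= minEle; case: ifP => _; lra.
- by have := valP a; rewrite /= minEle; case: ifP => _; lra.
- rewrite -lerBlDr le_min !lerBlDr.
  by apply/andP; split; rewrite ge_min; apply/orP; [left|right]; lra.
Qed.

Lemma path_dist_ge (phi : G -> R) (gS : generates S) :
  (forall x (s : S), `|phi (x * val s)%g - phi x| <= 1) ->
  forall x y, phi y - phi x <= dist (vertex x) (vertex y).
Proof.
move=> /edge_lipschitz_extension[f [fL fE]] x y.
have [l0 xy0] := pl_path_ex (vertex x) (vertex y) gS.
apply: lb_le_inf => [|l /= xy]; first by exists l0.
by have := pl_path_lipschitz fL xy; rewrite !fE; lra.
Qed.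

Lemma path_dist_edge x (s : S) : dist (vertex x) (vertex (x * val s)%g) <= 1.
Proof.
have := path_dist_le (pl_path_seg (on_edge_start R x s) (on_edge_end R x s)).
by rewrite sub0r normrN normr1.
Qed.

(** Moving a point to the origin of its edge costs at most 1, whence the constant 2 in both
    comparisons below. *)
Definition base (p : point) : G :=
  match p with inl x => x | inr (x, _, _) => x end.

Lemma path_dist_base p : dist p (vertex (base p)) <= 1.
Proof.
case: p => [x|[[x s] t]] /=; first by rewrite path_distxx.
have := path_dist_le
  (pl_path_seg (on_edge_interior x s t) (on_edge_start R x s)).
have /= /andP[t0 t1] := valP t.
by rewrite subr0 gtr0_norm// => /le_trans; apply; exact: ltW.
Qed.

Lemma path_dist_base_le (gS : generates S) p q :
  dist (vertex (base p)) (vertex (base q)) <= dist p q + 2.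
Proof.
have p1 := path_dist_base p; have q1 := path_dist_base q.
have := path_dist_triangle gS p (vertex (base p)) (vertex (base q)).
by have := path_dist_triangle gS q p (vertex (base q));
   rewrite [dist _ p]path_dist_sym; lra.
Qed.

Lemma path_dist_le_base (gS : generates S) p q :
  dist p q <= dist (vertex (base p)) (vertex (base q)) + 2.
Proof.
have p1 := path_dist_base p; have q1 := path_dist_base q.
have := path_dist_triangle gS (vertex (base p)) p q.
by have := path_dist_triangle gS (vertex (base q)) (vertex (base p)) q;
   rewrite [dist (vertex (base q)) q]path_dist_sym; lra.
Qed.

(* Stands for "the word length of [g] is at most [L]". *)
Definition displacement (g : G) (L : R) : Prop :=
  forall z, dist (vertex z) (vertex (z * g)%g) <= L.

Lemma displacement1 : displacement 1%g 0.
Proof. by move=> z; rewrite mulg1 path_distxx. Qed.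

Lemma displacementM (gS : generates S) g h L M :
  displacement g L -> displacement h M -> displacement (g * h)%g (L + M).
Proof.
move=> gL hM z; have := path_dist_triangle gS (vertex (z * g)%g) (vertex z)
  (vertex (z * g * h)%g).
by have := gL z; have := hM (z * g)%g; rewrite mulgA; lra.
Qed.

Lemma displacementV g L : displacement g L -> displacement (g^-1)%g L.
Proof.
by move=> gL z; have := gL (z * g^-1)%g; rewrite mulgVK path_dist_sym.
Qed.

Lemma displacement_ex (gS : generates S) g : exists L, displacement g L.
Proof.
apply: (generates_ind gS (P := fun g => exists L, displacement g L)).
- by exists 0; exact: displacement1.
- by move=> a b [L aL] [M bM]; exists (L + M); exact: displacementM.
- by move=> a [L aL]; exists L; exact: displacementV.
- by move=> s; exists 1 => z; exact: path_dist_edge.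
Qed.

(** By subadditivity, [N] grows along an edge labelled [s] by at most [N s] and drops by at most
    [N s^-1]. Hence [N (x^-1 v) / M] is 1-Lipschitz in [v] and [path_dist_ge] applies. *)
Lemma length_le_path_dist (gS : generates S) (N : G -> nat) :
  N 1%g = 0%N -> (forall g h, (N (g * h)%g <= N g + N h)%N) ->
  exists M : nat, (0 < M)%N /\
  forall x y, (N (x^-1 * y)%g)%:R <= M%:R * dist (vertex x) (vertex y).
Proof.
move=> N1 NM; pose M := (\max_(s : S) (N (val s) + N (val s)^-1%g)).+1.
have M0 : 0 < M%:R :> R by rewrite ltr0n.
exists M; split=> // x y.
pose phi (v : G) : R := (N (x^-1 * v)%g)%:R / M%:R.
rewrite -ler_pdivrMl// mulrC.
suff /(_ gS) : generates S -> phi y - phi x <= dist (vertex x) (vertex y).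
  by rewrite /phi mulVg N1 mul0r subr0.
move=> _; apply: path_dist_ge => // v s.
rewrite /phi mulgA -mulrBl normrM [X in _ * X]ger0_norm ?invr_ge0 ?(ltW M0)//.
rewrite ler_pdivrMr// mul1r.
have sM : (N (val s) + N (val s)^-1%g < M)%N.
  by rewrite ltnS; exact: (leq_bigmax s).
move: (x^-1 * v)%g => g; have := NM g (val s).
have := NM (g * val s)%g (val s)^-1%g; rewrite mulgK.
move: (N _) (N g) (N _) (N _) sM => a b c e *.
have [? ?] : (a <= b + M)%N /\ (b <= a + M)%N by lia.
rewrite ler_norml; apply/andP; split.
  by rewrite lerBrDr addrC lerBlDr -natrD ler_nat.
by rewrite lerBlDl -natrD ler_nat.
Qed.

Lemma sup_diam_bound (gS : generates S) (I : Type)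
    (B : I -> set (cayley_graph R gS)) :
  (ereal_sup [set diam (B i) | i in [set: I]] < +oo)%E ->
  exists C, forall i p q, B i p -> B i q -> dist p q <= C.
Proof.
move=> supB.
have le_sup i p q : B i p -> B i q ->
    ((dist p q)%:E <= ereal_sup [set diam (B i) | i in [set: I]])%E.
  move=> Bp Bq; apply: le_trans (ereal_sup_ubound _); last by exists i.
  by apply: ereal_sup_ubound; exists (p, q).
(* The supremum is [-oo] when no piece has a point; any bound then works. *)
move: (ereal_sup _) supB le_sup => [C| |] // _ le_sup; last first.
  by exists 0 => i p q Bp /(le_sup _ _ _ Bp).
by exists C => i p q Bp /(le_sup _ _ _ Bp).
Qed.

Lemma set_dist_le (gS : generates S) (A B : set (cayley_graph R gS)) p q :
  A p -> B q -> (set_dist A B <= (dist p q)%:E)%E.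
Proof. by move=> Ap Bq; apply: ereal_inf_lbound; exists (p, q). Qed.

(** An edge, of length 1, cannot join pieces at distance at least 2; by connectedness a single piece
    contains all vertices. *)
Lemma asdim_le0_bounded (gS : generates S) :
  asdim_le (cayley_graph R gS) 0 ->
  exists C, forall x, dist (vertex 1%g) (vertex x) <= C.
Proof.
move=> /(_ 2 (ltr0Sn _ 1))[Y [Ycover /(_ ord0)[I [B [YB supB farB]]]]].
have cover (p : cayley_graph R gS) : exists i, B i p.
  have : [set: cayley_graph R gS] p by [].
  rewrite Ycover => -[k _]; rewrite (ord1 k) YB => -[i _ Bip].
  by exists i.
have [C BC] := sup_diam_bound supB.
have [i0 B1] := cover (vertex 1%g).
exists C => x; apply: (BC i0) => //.
have near_piece p q i : dist p q <= 1 -> B i p -> B i q.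
  move=> pq Bp; have [j Bq] := cover q.
  have [->//|ij] := pselect (i = j).
  have := le_trans (farB _ _ ij) (set_dist_le Bp Bq).
  by rewrite lee_fin leNgt (le_lt_trans pq)// ltr1n.
(* The equivalence, unlike an implication, passes to inverses. *)
suff /(_ 1%g) : forall z, B i0 (vertex z) <-> B i0 (vertex (z * x)%g).
  by rewrite mul1g => -[] + _; apply.
apply: (generates_ind gS (P := fun g => forall z,
  B i0 (vertex z) <-> B i0 (vertex (z * g)%g))).
- by move=> z; rewrite mulg1.
- by move=> g h Bg Bh z; rewrite mulgA -Bh.
- by move=> g Bg z; rewrite (Bg (z * g^-1)%g) mulgVK.
- move=> s z; have zs := path_dist_edge z s.
  by split; apply: near_piece; rewrite // path_dist_sym.
Qed.

End CayleyMetric.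

(** * The lamplighter group *)

Local Notation wr f n := ((f%R, n%R) : wreathZ _).

Section WreathLength.
Variable A : zmodType.
Implicit Types (f : dsum A) (g h : wreathZ A).

Definition dsum_delta (i : int) (a : A) : dsum A :=
  [fsfun j in [fset i]%fset => a].

Lemma dsum_deltaE i a j : dsum_fun (dsum_delta i a) j = if j == i then a else 0.
Proof. by rewrite /dsum_fun fsfunE inE. Qed.

Lemma dsum0_eval i : dsum_fun (0 : dsum A) i = 0.
Proof. exact: dsum0E. Qed.

Lemma dsum_add_eval f1 f2 i :
  dsum_fun (f1 + f2) i = dsum_fun f1 i + dsum_fun f2 i.
Proof. exact: dsum_addE. Qed.

Lemma dsum_opp_eval f i : dsum_fun (- f) i = - dsum_fun f i.
Proof. exact: dsum_oppE. Qed.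

Lemma shift_0 k : shift k (0 : dsum A) = 0.
Proof. by apply: dsumP => i; rewrite shiftE !dsum0_eval. Qed.

Lemma dsum_supp f : exists s : seq int, forall i, dsum_fun f i != 0 -> i \in s.
Proof.
exists (enum_fset (finsupp (f : {fsfun int -> A with 0}))) => i.
by rewrite /dsum_fun -mem_finsupp.
Qed.

Lemma dsum_split i (s : seq int) f :
  (forall j, dsum_fun f j != 0 -> j \in i :: s) ->
  exists f', f = dsum_delta i (dsum_fun f i) + f' /\
    forall j, dsum_fun f' j != 0 -> j \in s.
Proof.
move=> fs; exists (f - dsum_delta i (dsum_fun f i)); split.
  by rewrite addrC subrK.
move=> j; rewrite dsum_add_eval dsum_opp_eval dsum_deltaE.
case: (eqVneq j i) => [->|ji]; first by rewrite subrr eqxx.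
by rewrite subr0 => /fs; rewrite inE (negPf ji).
Qed.

Lemma wreath_mulE g h :
  (g * h)%g = (g.1 + shift g.2 h.1, g.2 + h.2) :> wreathZ A.
Proof. by []. Qed.

Lemma wreath_invE g : (g^-1)%g = (shift (- g.2) (- g.1), - g.2) :> wreathZ A.
Proof. by []. Qed.

(** The function [N] of the overview. It vanishes on lamps at [0], so it is not a word length. *)
Definition wreath_length (g : wreathZ A) : nat :=
  maxn `|g.2| (\max_(i <- finsupp (g.1 : {fsfun int -> A with 0})) `|i|).

Lemma wreath_length_le g m : (wreath_length g <= m)%N <->
  (`|g.2| <= m)%N /\ forall i, dsum_fun g.1 i != 0 -> (`|i| <= m)%N.
Proof.
rewrite /wreath_length geq_max; split=> [/andP[-> /bigmax_leqP_seq gm]|[-> gm]].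
  by split=> // i gi; apply: gm; rewrite ?mem_finsupp.
by apply/bigmax_leqP_seq => i; rewrite mem_finsupp => /gm.
Qed.

Lemma wreath_length1 : wreath_length 1%g = 0%N.
Proof.
apply/eqP; rewrite -leqn0; apply/wreath_length_le; split=> // i /=.
by rewrite dsum0_eval eqxx.
Qed.

Lemma wreath_lengthM g h :
  (wreath_length (g * h)%g <= wreath_length g + wreath_length h)%N.
Proof.
have /wreath_length_le[g2 g1] := leqnn (wreath_length g).
have /wreath_length_le[h2 h1] := leqnn (wreath_length h).
apply/wreath_length_le; rewrite wreath_mulE /=; split; first by lia.
move=> i; rewrite dsum_add_eval shiftE => gh.
have [g0|/g1] := eqVneq (dsum_fun g.1 i) 0; last by lia.
by move: gh; rewrite g0 add0r => /h1; lia.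
Qed.

Lemma wreath_decomp g : g = (wr g.1 0 * wr 0 g.2)%g.
Proof. by rewrite wreath_mulE /= shift_0 addr0 add0r -surjective_pairing. Qed.

Lemma wreath_delta_conj i a : wr (dsum_delta i a) 0 =
  (wr 0 i * wr (dsum_delta 0 a) 0 * wr 0 (- i))%g.
Proof.
rewrite !wreath_mulE /= addr0 subrr shift_0 addr0 add0r; congr pair.
by apply: dsumP => j; rewrite shiftE !dsum_deltaE subr_eq0.
Qed.

End WreathLength.

(** * Finite generation and asymptotic dimension, for finite [A] *)

Section FiniteBase.
Variable A : finZmodType.

(** The unit translation and the lamps at [0] generate: conjugation by translations gives lamps
    everywhere, and products give all finite supports. *)
Lemma wreath_fin_generated : exists S : {fset wreathZ A}, generates S.
Proof.
exists [fset x in ((0, 1) : wreathZ A) ::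
  codom (fun a : A => (dsum_delta 0 a, 0) : wreathZ A)]%fset => H SH.
have H1 : ((0, 1) : wreathZ A) \in H by apply: SH; rewrite !inE eqxx.
have Hd a : ((dsum_delta 0 a, 0) : wreathZ A) \in H.
  by apply: SH; rewrite !inE codom_f orbT.
have H0 : wr 0 0 \in H by rewrite -[_ \in _]/(1%g \in H) gpred1.
have Hpos n : ((0, n%:Z) : wreathZ A) \in H.
  elim: n => [|n IH]; first exact: H0.
  rewrite (_ : (0, _) = (wr 0 1 * wr 0 n%:Z)%g :> wreathZ A) ?gpredM//.
  by rewrite wreath_mulE /= shift_0 addr0 -intS.
have Hn n : ((0, n) : wreathZ A) \in H.
  case: n => n; first exact: Hpos.
  rewrite (_ : (0, _) = ((wr 0 n.+1%:Z)^-1)%g :> wreathZ A) ?gpredVr//.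
  by rewrite wreath_invE /= oppr0 shift_0 NegzE.
have Hdelta i a : ((dsum_delta i a, 0) : wreathZ A) \in H.
  by rewrite wreath_delta_conj !gpredM.
move=> g; rewrite [g]wreath_decomp gpredM//; move: g.1 => f.
have [s fs] := dsum_supp f; elim: s f fs => [|i s IH] f fs.
  suff -> : f = 0 by exact: H0.
  apply: dsumP => i; rewrite dsum0_eval.
  by apply/eqP; apply: contraT => /fs.
have [f' [-> /IH f'H]] := dsum_split fs.
rewrite (_ : (_, _) = (wr (dsum_delta i (dsum_fun f i)) 0 * wr f' 0)%g
  :> wreathZ A).
  by rewrite gpredM.
by rewrite wreath_mulE /= shift0 addr0.
Qed.

Section Cayley.
Variables (R : realType) (S : {fset wreathZ A}) (gS : generates S).

Lemma displacement_fin (T : finType) (g : T -> wreathZ A) :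
  exists L : R, forall t, displacement S (g t) L.
Proof.
have /choice[L gL] : forall t, exists L : R, displacement S (g t) L.
  by move=> t; exact: displacement_ex.
exists (\sum_t `|L t|) => t z; apply: (le_trans (gL t z)).
rewrite (bigD1 t)//=; apply: (le_trans (ler_norm _)).
by rewrite lerDl sumr_ge0.
Qed.

(** Only finitely many values are possible at each place of [s], so the bound is uniform in [f]. *)
Lemma displacement_supp (s : seq int) : exists L : R, forall f,
  (forall i, dsum_fun f i != 0 -> i \in s) ->
  displacement S ((f, 0) : wreathZ A) L.
Proof.
elim: s => [|i s [L IH]].
  exists 0 => f fs; suff -> : f = 0 by exact: displacement1.
  apply: dsumP => i; rewrite dsum0_eval.
  by apply/eqP; apply: contraT => /fs.
have [K dK] := displacement_fin (fun a => (dsum_delta i a, 0) : wreathZ A).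
exists (K + L) => f /dsum_split[f' [-> /IH f'L]].
rewrite (_ : (_, _) = (wr (dsum_delta i (dsum_fun f i)) 0 * wr f' 0)%g
  :> wreathZ A).
  exact: displacementM.
by rewrite wreath_mulE /= shift0 addr0.
Qed.

Lemma displacement_ball (m : nat) : exists L : R, forall g,
  (wreath_length g <= m)%N -> displacement S g L.
Proof.
(* [c] enumerates the [2m + 1] integers of absolute value at most [m]. *)
pose c (k : 'I_(m + m).+1) : int := k%:Z - m%:Z.
have int_ball n : (`|n| <= m)%N -> exists k, n = c k.
  move=> nm; have km : (`|(n + m%:Z)%R| < (m + m).+1)%N by lia.
  by exists (Ordinal km); rewrite /c /=; lia.
have [K cK] := displacement_fin (fun k => (0, c k) : wreathZ A).
have [L sL] := displacement_supp [seq c k | k <- enum 'I_(m + m).+1].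
exists (L + K) => g /wreath_length_le[g2 g1]; rewrite [g]wreath_decomp.
apply: displacementM => //.
  apply: sL => i /g1/int_ball[k ->]; exact/map_f/mem_enum.
by have [k ->] := int_ball _ g2.
Qed.

Local Notation base := (@base R (wreathZ A) S).
Local Notation dist := (@path_dist R (wreathZ A) S).

Lemma wreath_asdim_gt0 n : asdim_le (cayley_graph R gS) n -> (0 < n)%N.
Proof.
case: n => // /asdim_le0_bounded[C dC].
have [M [M0 lM]] :=
  length_le_path_dist R gS (@wreath_length1 A) (@wreath_lengthM A).
have C0 : 0 <= C by have := dC 1%g; rewrite path_distxx.
have := archi_boundP (mulr_ge0 (ler0n R M) C0).
(* Translation by [b > M * C] has length at least [b], too much for a vertex within [C] of [1]. *)
set b := Num.bound _ => MCb; pose g : wreathZ A := (0, b%:Z).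
have := lM 1%g g; rewrite invg1 mul1g => gM.
have /wreath_length_le[/= bg _] := leqnn (wreath_length g).
have : b%:R <= M%:R * C.
  apply: le_trans (ler_wpM2l (ler0n R M) (dC g)).
  by apply: le_trans gM; rewrite ler_nat.
by rewrite leNgt MCb.
Qed.

Lemma wreath_asdim_le1 : asdim_le (cayley_graph R gS) 1.
Proof.
move=> d d0.
have [M [M0 lM]] :=
  length_le_path_dist R gS (@wreath_length1 A) (@wreath_lengthM A).
have Md0 : 0 <= M%:R * (d + 2) by rewrite mulr_ge0// addr_ge0// ltW.
(* [m > M (d + 2)]: points less than [d] apart have bases at most [d + 2] apart, with quotient of
   length less than [m]. *)
have := archi_boundP Md0; set m := Num.bound _ => Mdm.
have m0 : (0 < m)%N by rewrite -(ltr0n R); exact: le_lt_trans Mdm.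
have near_length p q : dist p q < d ->
    (wreath_length ((base p)^-1 * base q)%g < m)%N.
  move=> pq; rewrite -(ltr_nat R); apply: le_lt_trans Mdm.
  apply: (le_trans (lM _ _)); rewrite ler_wpM2l//.
  by apply: (le_trans (path_dist_base_le gS p q)); rewrite lerD2r ltW.
pose cell p : int := ((base p).2 %/ m%:Z)%Z.
(* The masked window, of radius [2m] about the left end of the cell, contains the [m]-neighbourhood
   of the cell. *)
pose outer p : int -> A := fun i =>
  if (`|(i - cell p * m%:Z)%R| <= 2 * m)%N then 0 else dsum_fun (base p).1 i.
pose parity (j : 'I_2) p := (cell p %% 2)%Z = (j : nat)%:Z.
have cellP p : cell p * m%:Z <= (base p).2 < (cell p + 1) * m%:Z.
  have mz : 0 < m%:Z by lia.
  have := divz_eq (base p).2 m; have := ltz_pmod (base p).2 mz.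
  have := modz_ge0 (base p).2 (lt0r_neq0 mz).
  by rewrite mulrDl mul1r -/(cell p); lia.
exists (fun j => [set p | parity j p]); split.
  apply/seteqP; split=> // p _.
  have j2 : (`|(cell p %% 2)%Z| < 2)%N by lia.
  by exists (Ordinal j2) => //; rewrite /parity /=; lia.
move=> j.
exists (int * (int -> A))%type,
  (fun kf => [set p | [/\ parity j p, cell p = kf.1 & outer p = kf.2]]).
split.
- apply/seteqP; split=> p /=; last by case=> kf _ [].
  by move=> jp; exists (cell p, outer p).
(* Within a piece, configurations differ only in the window, hence less than [3m] away from the
   position of [p]. *)
- have [L ballL] := displacement_ball (3 * m).
  apply: (@le_lt_trans _ _ (L + 2)%:E); last exact: ltry.
  apply: ge_ereal_sup => _ [[k f] _ <-].
  apply: ge_ereal_sup => _ [[p q] [/= pP qP] <-].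
  rewrite lee_fin; apply: (le_trans (path_dist_le_base gS p q)).
  rewrite lerD2r -[base q](mulVKg (base p)); apply: ballL.
  case: pP qP => _ pk pf [_ qk qf].
  have := cellP p; have := cellP q; rewrite pk qk => /andP[q1 q2] /andP[p1 p2].
  apply/wreath_length_le; rewrite wreath_mulE wreath_invE /=.
  split; first by lia.
  move=> i; rewrite dsum_add_eval !shiftE dsum_opp_eval opprK.
  move: (congr1 (@^~ (i + (base p).2)) pf) (congr1 (@^~ (i + (base p).2)) qf).
  rewrite /outer pk qk; case: ifPn => [|_ -> ->]; first by lia.
  by rewrite addNr eqxx.
- move=> [k f] [k' f'] kf; apply/ereal_infP => _ [[p q] [/= pP qP] <-].
  rewrite lee_fin leNgt; apply/negP => /near_length/ltnW.
  move=> /wreath_length_le; rewrite wreath_mulE wreath_invE /= => -[pq2 pq1].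
  case: pP qP => pj pk pf [qj qk qf].
  (* Between distinct cells of equal parity lies a whole cell, so positions in them differ by more
     than [m]. *)
  have kk' : k = k'.
    have := cellP p; have := cellP q; move: pj qj; rewrite /parity pk qk.
    have far (a b : int) : (a + 2 <= b) -> (a + 2) * m%:Z <= b * m%:Z.
      by move=> ab; rewrite ler_wpM2r.
    move=> pj qj /andP[q1 q2] /andP[p1 p2]; have := far k k'; have := far k' k.
    by lia.
  apply: kf; rewrite -{k'}kk' in qk *; congr pair.
  rewrite -pf -qf /outer pk qk; apply/funext => i.
  case: ifPn => // ikm; apply/eqP; rewrite eq_sym -subr_eq0; apply: contraT.
  (* A difference at [i] occurs within [m] of the position of [p], hence inside the window. *)
  have := pq1 (i - (base p).2).
  rewrite dsum_add_eval !shiftE dsum_opp_eval opprK subrK addrC => h /h.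
  by have := cellP p; rewrite pk => /andP[p1 p2]; nia.
Qed.

End Cayley.
End FiniteBase.

(** * Involutions in finite index subgroups *)

Lemma finite_index_pigeonhole (G : groupType) (P : {pred G}) (x : nat -> G) :
  1%g \in P -> finite_index P ->
  exists i j, i <> j /\ ((x i)^-1 * x j)%g \in P.
Proof.
move=> P1 finP; apply: contrapT => nij.
pose c n : set G := [set (x n * h)%g | h in [set` P]].
(* If no quotient lay in [P], the cosets of the [x n] would be pairwise distinct. *)
have cinj : injective c.
  move=> i j cij; apply: contrapT => ij; apply: nij; exists i, j; split=> //.
  have : c j (x j) by exists 1%g; rewrite //= mulg1.
  by rewrite -cij => -[h /= hP <-]; rewrite mulKg.
have : finite_set (range c).
  by apply: sub_finite_set finP => _ [n _ <-]; exists (x n).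
move=> /(finite_preimage (in2W cinj)).
by rewrite preimage_range; exact: infinite_nat.
Qed.

(** Among the lamps [a] at the natural numbers, two have their quotient in the subgroup; it is an
    involution, which a free group cannot contain. *)
Lemma wreath_not_virtually_free (A : zmodType) (a : A) :
  a != 0 -> a + a = 0 -> ~ virtually_free (wreathZ A).
Proof.
move=> a0 aa [P [H [finP freeH]]].
have P1 : 1%g \in P by rewrite -(val1 H); exact: valP.
pose x (n : nat) : wreathZ A := (dsum_delta n%:Z a, 0).
have [i [j [ij xP]]] := finite_index_pigeonhole x P1 finP.
have ijE : ((x i)^-1 * x j)%g = wr (dsum_delta j%:Z a - dsum_delta i%:Z a) 0.
  by rewrite wreath_mulE wreath_invE /= oppr0 !shift0 addr0 addrC.
rewrite ijE in xP.
case: (insubP H (wr (dsum_delta j%:Z a - dsum_delta i%:Z a) 0));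
  last by move=> /negP.
move=> u _ uE.
have uu : (u * u)%g = 1%g.
  apply: val_inj; rewrite valM val1 uE wreath_mulE /= shift0 addr0.
  congr pair; apply: dsumP => k.
  rewrite !dsum_add_eval dsum_opp_eval !dsum_deltaE.
  rewrite dsum0_eval addrACA -opprD.
  by case: eqP => _; case: eqP => _; rewrite ?aa ?addr0 ?subrr.
have /(congr1 val) := free_group_no_involution freeH uu.
rewrite uE val1 => -[/(congr1 (fun f : dsum A => dsum_fun f j%:Z))].
rewrite dsum_add_eval dsum_opp_eval !dsum_deltaE eqxx dsum0_eval.
case: eqP => [[/esym//]|_]; rewrite subr0 => /eqP.
by rewrite (negPf a0).
Qed.

Theorem mainTheorem3 (R : realType) :
  group_asdim_eq R (wreathZ 'Z_2) 1 /\ ~ virtually_free (wreathZ 'Z_2).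
Proof.
split; last by apply: (@wreath_not_virtually_free 'Z_2 1) => //; apply/val_inj.
split; first exact: (wreath_fin_generated 'Z_2).
move=> S gS; split; first exact: (@wreath_asdim_le1 'Z_2).
by move=> m; exact: (@wreath_asdim_gt0 'Z_2).
Qed.
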